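(* The period quintupling renormalization operator $R$ defined on $C^{1+Lip}$ unimodal maps has infinite topological entropy and it has a continuum of fixed points.
   Context: A unimodal map is a $C^1$ map $f:[0,1]\to[0,1]$ with a unique critical point $c$, normalized here by $f(c)=1$, $f(1)=0$. It is $C^{1+Lip}$ if its derivative is Lipschitz. $f$ is period quintupling renormalizable if $f^3(0)<c<f^8(0)$ and, with $J=[f^3(0),f^8(0)]$ a proper subinterval, the intervals $f^2(J),J,f^3(J),f^4(J),f(J)$ have pairwise disjoint interiors, lie in this order from left to right, and $f^5(J)\subset J$. Then $Rf=h^{-1}\circ f^5\circ h$ with $h:[0,1]\to J$ the orientation reversing affine homeomorphism; the operator $R$ is defined on the set of period quintupling renormalizable $C^{1+Lip}$ unimodal maps. The topological entropy of $R$ is the supremum of $h_{top}(R|_\Lambda)$ over compact (in the $C^1$ topology) sets $\Lambda$ in its domain with $R(\Lambda)\subset\Lambda$ on which $R$ is continuous. A fixed point is a map with $Rf=f$; ''a continuum of fixed points'' means a family of pairwise distinct fixed points having the cardinality of the continuum. *)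

(* Defs.v *)
From mathcomp Require Import all_boot all_order all_algebra finmap.
From mathcomp Require Import all_classical all_reals all_analysis.

Set Implicit Arguments.
Unset Strict Implicit.
Unset Printing Implicit Defensive.

Import Order.TTheory GRing.Theory Num.Theory.
Import numFieldNormedType.Exports.

Local Open Scope classical_set_scope.
Local Open Scope ring_scope.

(** * Topological entropy (Bowen's definition, for uniform spaces) *)

Section Entropy.
Variables (R : realType) (T : uniformType).
Implicit Types (f : T -> T) (A : set T) (E : set (T * T)) (n : nat).

Definition bowen_separated f n E (S : set T) : Prop :=
  forall x y, S x -> S y -> x <> y ->
    exists2 i, (i < n)%N & ~ E (iter i f x, iter i f y).

(** Maximal cardinality of a finite [(n, E)]-separated subset of [A]. *)
Definition sep_number f A n E : \bar R :=
  ereal_sup [set (#|` S|%:R)%:E | S in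
    [set S : {fset T} | [set` S] `<=` A /\ bowen_separated f n E [set` S]]].

(** The supremum over the entourages [E] is the limit as [E] shrinks to the
    diagonal, by monotonicity; in a metric space it is the limit as
    epsilon tends to 0. *)
Definition topological_entropy f A : \bar R :=
  ereal_sup [set limn_esup (fun n => ((n%:R^-1)%:E * lne (sep_number f A n E))%E)
            | E in entourage].

End Entropy.

Arguments topological_entropy R {T} f A.

(** * Maps of the unit interval *)

Section Maps.
Variable R : realType.
Implicit Types (f : R -> R) (c : R).

Definition unit_itv : set R := [set x | 0 <= x <= 1].

(** Derivative relative to [0, 1], hence one-sided at 0 and at 1. *)
Definition diff_quot f (x y : R) : R := (f y - f x) / (y - x).

Definition derivable01 f (x : R) : Prop :=
  cvg (diff_quot f x y @[y --> within unit_itv x^']).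

Definition derive01 f (x : R) : R :=
  lim (diff_quot f x y @[y --> within unit_itv x^']).

(** A map from [0, 1] to [0, 1] is encoded as a function on [R] that
    vanishes outside [0, 1], so that equality of such functions is equality of
    maps on [0, 1]. *)
Definition selfmap01 f : Prop :=
  (forall x, unit_itv x -> unit_itv (f x)) /\
  (forall x, ~ unit_itv x -> f x = 0).

Definition C1map01 f : Prop :=
  [/\ selfmap01 f,
      (forall x, unit_itv x -> derivable01 f x) &
      {within unit_itv, continuous (derive01 f)}].

Definition unimodal f c : Prop :=
  [/\ C1map01 f,
      unit_itv c,
      (forall x, unit_itv x -> (derive01 f x = 0 <-> x = c)),
      f c = 1 &
      f 1 = 0].

Definition C1Lip f : Prop := [lipschitz (derive01 f) x | x in unit_itv].

(** The C^1 topology (and uniformity): uniform convergence on [0, 1] of the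
    map and of its derivative.  It is put on all functions, but is only used
    on sets of C^1 maps of [0, 1]. *)
Definition jet1 f : {uniform` unit_itv -> R} * {uniform` unit_itv -> R} :=
  (f, derive01 f).

Definition C1space : uniformType := initial_topology jet1.

(** * Period quintupling renormalization *)

Definition renorm_itv f : set R := [set x | iter 3 f 0 <= x <= iter 8 f 0].

(** Position, from left to right, of the iterated images of the
    renormalization interval. *)
Definition quintupling_order : seq nat := [:: 2; 0; 3; 4; 1]%N.

Definition quintupling_renormalizable f : Prop :=
  exists c, unimodal f c /\
    let J := renorm_itv f in
    let image k := iter (nth 0%N quintupling_order k) f @` J in
    [/\ iter 3 f 0 < c < iter 8 f 0,
        J `<` unit_itv,
        (forall i j, (i < j < 5)%N ->
           (image i)° `&` (image j)° = set0 /\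
           (forall x y, image i x -> image j y -> x <= y)) &
        iter 5 f @` J `<=` J].

(** [line_path b a] is the affine map sending 0 to [b] and 1 to [a], and
    [factor b a] is its inverse; here [a < b] are the end points of the
    renormalization interval, so the rescaling reverses orientation. *)
Definition renorm (f : C1space) : C1space :=
  let a := iter 3 f 0 in
  let b := iter 8 f 0 in
  patch (fun=> 0) unit_itv
    (fun x => factor b a (iter 5 f (line_path b a x))).

Definition renorm_domain : set C1space :=
  [set f | quintupling_renormalizable f /\ C1Lip f].

Definition renorm_entropy : \bar R :=
  ereal_sup [set topological_entropy R renorm L | L in
    [set L : set C1space |
      [/\ L `<=` renorm_domain,
          compact L,
          renorm @` L `<=` L &
          {within L, continuous renorm}]]].

Definition renorm_fixed : set C1space :=
  [set f | renorm_domain f /\ renorm f = f].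

End Maps.

Arguments renorm_fixed R : clear implicits.

(* Main.v *)
Require Import Defs.
From mathcomp Require Import all_boot all_order all_algebra finmap.
From mathcomp Require Import all_classical all_reals all_analysis.
From mathcomp Require Import ring lra.

(** The operator [renorm] does not control the shape of a map away from its
    renormalization interval, and a Lipschitz derivative allows independent
    choices of shape, of the same relative size, at all renormalization scales.
    So the full shift on the alphabet [0, 1] embeds in [renorm].

    The maps are built as follows.  Let [c] be the critical point and
    [J = [a, b]] the renormalization interval, of length [lam].  If [f] is
    affine on each of [f(J)], [f^2(J)], [f^3(J)] and [f^4(J)], then
    [renorm f = g] says that near its critical point [f] is an affine copy of
    [g]: [f (b - lam x) = 1 - mu (1 - g x)] on [0, 1], where [mu] is the length
    of [f(J)] ([qmap_renorm_itv], [renorm_qmap]).  For a sequence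
    [w : nat -> [0, 1]], let [f_w] have at scale [k], that is on the [k]-th
    nested interval minus the next one, a fixed shape plus [w k] times a bump
    that avoids the five intervals.  Then [renorm f_w] is the map of the
    shifted sequence.

    Choosing [mu = lam ^ 2] makes this self-similarity compatible with a
    Lipschitz derivative, because rescaling by [(lam, lam ^ 2)] preserves the
    size of the second derivative and preserves the parabola [1 - K u ^ 2],
    [u = x - c].  So [f_w] is taken to be this parabola plus a sum over [k] of
    rescaled corrections [lam ^ (2 k) * corr (w k) (u / (- lam) ^ k)], where
    [corr t] is a [C^1] quadratic spline supported in the annulus
    [lam rho < |v| < rho]; the supports are disjoint for distinct [k].
    At scale 0 the correction replaces the two sides of the parabola by tangent
    lines, so that [f_w] is a tent with rounded top (and a bump).

    Being [C^{1+Lip}] is encoded by the single inequality [taylor2],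
    [|f y - f x - g x (y - x)| <= L (y - x) ^ 2], which survives sums, the
    rescaling and the summation of terms with disjoint supports
    ([taylor2_tower]); it gives at once that [g] is the derivative of [f], also
    at the critical point where the scales accumulate, and that [g] is
    Lipschitz.

    The constants come from a tent with slopes [9/5] on the left and [- 5/3] on
    the right.  The return [f^4 : f(J) -> J] has slope [9/5 * (5/3) ^ 3 = 25/3] in
    absolute value, whence [lam = mu * 25/3] and [lam = 3/25].  The equations
    [f 1 = 0] and [f^3 0 = c - lam (1 - c)], the left end of [J], are linear in
    [c] and [1 / K], and give [c = 37/108] and [K = 225/31].

    Finally, the family of all [f_w] is compact, as a continuous image of the
    product [0, 1]^nat ([compact_code_family]); words over the alphabet
    [{0, 1/M, ..., (M-1)/M}] give [M ^ n] points that are separated in time [n]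
    at a scale independent of [n], so the entropy is at least [ln M] for all
    [M] ([code_family_entropy_ge]); and the constant sequences give the continuum
    of fixed points. *)

Set Implicit Arguments.
Unset Strict Implicit.
Unset Printing Implicit Defensive.

Import Order.TTheory GRing.Theory Num.Theory.
Import numFieldNormedType.Exports.

Local Open Scope classical_set_scope.
Local Open Scope ring_scope.

(** * Functions with a uniform first-order expansion *)

Section Taylor.
Context {R : realType}.
Implicit Types (f g : R -> R) (L a p q : R).

(** This expresses that [g] is the derivative of [f] and is Lipschitz, without
    any limit, and so makes the sum over infinitely many scales elementary. *)
Definition taylor2 L f g : Prop :=
  forall x y, `|f y - f x - g x * (y - x)| <= L * (y - x) ^+ 2.

Lemma taylor2D L1 L2 f1 g1 f2 g2 : taylor2 L1 f1 g1 -> taylor2 L2 f2 g2 ->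
  taylor2 (L1 + L2) (fun u => f1 u + f2 u) (fun u => g1 u + g2 u).
Proof.
move=> T1 T2 x y; rewrite [leRHS]mulrDl; apply: le_trans (lerD (T1 x y) (T2 x y)).
by apply: le_trans (ler_normD _ _); rewrite le_eqVlt; apply/orP; left; apply/eqP; congr `|_|; ring.
Qed.

Lemma taylor2Z L a f g : taylor2 L f g ->
  taylor2 (`|a| * L) (fun u => a * f u) (fun u => a * g u).
Proof.
move=> T x y; have -> : a * f y - a * f x - a * g x * (y - x) =
  a * (f y - f x - g x * (y - x)) by ring.
by rewrite normrM -mulrA ler_wpM2l.
Qed.

(** With [p = 1 / r], composing with [u |-> u / r] and multiplying by [r ^ 2]
    keeps the constant [L]: this is the scale invariance behind the
    construction. *)
Lemma taylor2_comp_affine L p q f g : taylor2 L f g ->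
  taylor2 (L * p ^+ 2) (fun u => f (p * u + q)) (fun u => p * g (p * u + q)).
Proof.
move=> T x y; have := T (p * x + q) (p * y + q).
have -> : p * y + q - (p * x + q) = p * (y - x) by ring.
by rewrite exprMn !mulrA [g _ * p]mulrC.
Qed.

Lemma taylor2W L1 L2 f g : L1 <= L2 -> taylor2 L1 f g -> taylor2 L2 f g.
Proof.
by move=> le12 T x y; apply: le_trans (T x y) _; rewrite ler_wpM2r ?sqr_ge0.
Qed.

(** Adding the expansions from [x] to [y] and from [y] to [x] eliminates [f]. *)
Lemma taylor2_lipschitz L f g : taylor2 L f g ->
  forall x y, `|g x - g y| <= 2 * L * `|x - y|.
Proof.
move=> T x y; have [->|xy] := eqVneq x y; first by rewrite !subrr normr0 mulr0.
have d0 : 0 < `|x - y| by rewrite normr_gt0 subr_eq0.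
have d2 : `|x - y| * `|x - y| = (x - y) ^+ 2 by rewrite -expr2 real_normK ?num_real.
rewrite -(ler_pM2r d0) -normrM -[leRHS]mulrA d2.
have -> : (g x - g y) * (x - y) =
  (f y - f x - g x * (y - x)) + (f x - f y - g y * (x - y)) by ring.
apply: le_trans (ler_normD _ _) _; apply: le_trans (lerD (T x y) (T y x)) _.
by rewrite le_eqVlt; apply/orP; left; apply/eqP; ring.
Qed.

Lemma taylor2_sqr a : taylor2 `|a| (fun u => a * u ^+ 2) (fun u => a * (2 * u)).
Proof.
rewrite -[X in taylor2 X]mulr1; apply: taylor2Z => x y.
have -> : y ^+ 2 - x ^+ 2 - 2 * x * (y - x) = (y - x) ^+ 2 by ring.
by rewrite mul1r ger0_norm ?sqr_ge0.
Qed.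

Lemma taylor2_cst a : taylor2 0 (fun=> a) (fun=> 0).
Proof. by move=> x y; rewrite subrr !mul0r subr0 normr0. Qed.

End Taylor.

(** * A quadratic B-spline *)

Section QuadraticSpline.
Context {R : realType}.
Implicit Types z : R.

Definition ppart z : R := Num.max 0 z.

Variant ppart_spec z : R -> Prop :=
| PpartNeg of z <= 0 : ppart_spec z 0
| PpartPos of 0 <= z : ppart_spec z z.

Lemma ppartP z : ppart_spec z (ppart z).
Proof. by rewrite /ppart; have [z0|/ltW z0] := leP 0 z; constructor. Qed.

Lemma taylor2_ppart : taylor2 1 (fun z => ppart z ^+ 2) (fun z => 2 * ppart z).
Proof.
move=> x y; rewrite mul1r ler_norml.
have := sqr_ge0 (y - x).
case: (ppartP x) => hx; case: (ppartP y) => hy sq0; apply/andP; split; nra.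
Qed.

(** The quadratic B-spline with knots 0, 4, 5, 6, normalized to be [z ^ 2] on
    its first piece; the other coefficients are forced by the vanishing beyond
    the last knot.  The long first piece is where a parabola gets replaced by
    its tangent line; the short pieces return to the parabola quickly enough to
    fit in an annulus.  The arguments are written [1 * z + - 4] to match
    [taylor2_comp_affine]. *)
Definition bspline z :=
  ppart z ^+ 2 + - 15 * ppart (1 * z + - 4) ^+ 2 +
  24 * ppart (1 * z + - 5) ^+ 2 + - 10 * ppart (1 * z + - 6) ^+ 2.

Definition dbspline z :=
  2 * ppart z + - 15 * (1 * (2 * ppart (1 * z + - 4))) +
  24 * (1 * (2 * ppart (1 * z + - 5))) + - 10 * (1 * (2 * ppart (1 * z + - 6))).

Lemma taylor2_bspline : taylor2 50 bspline dbspline.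
Proof.
have T (a b : R) : taylor2 `|a| (fun z => a * ppart (1 * z + b) ^+ 2)
    (fun z => a * (1 * (2 * ppart (1 * z + b)))).
  by have := taylor2Z a (taylor2_comp_affine 1 b taylor2_ppart); rewrite expr1n !mulr1.
have := taylor2D (taylor2D (taylor2D taylor2_ppart (T (- 15) (- 4))) (T 24 (- 5)))
  (T (- 10) (- 6)).
by apply: taylor2W; rewrite !normrN !ger0_norm; lra.
Qed.

Ltac ppart_cases z := case: (ppartP z) => ?; case: (ppartP (1 * z + - 4)) => ?;
  case: (ppartP (1 * z + - 5)) => ?; case: (ppartP (1 * z + - 6)) => ?.

Lemma bspline_le0 z : z <= 0 -> bspline z = 0.
Proof. by rewrite /bspline => ?; ppart_cases z; nra. Qed.

Lemma dbspline_le0 z : z <= 0 -> dbspline z = 0.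
Proof. by rewrite /dbspline => ?; ppart_cases z; lra. Qed.

Lemma bspline_ge6 z : 6 <= z -> bspline z = 0.
Proof. by rewrite /bspline => ?; ppart_cases z; nra. Qed.

Lemma dbspline_ge6 z : 6 <= z -> dbspline z = 0.
Proof. by rewrite /dbspline => ?; ppart_cases z; lra. Qed.

Lemma bspline_sqr z : 0 <= z <= 4 -> bspline z = z ^+ 2.
Proof. by rewrite /bspline => ?; ppart_cases z; nra. Qed.

Lemma bspline_ge0 z : 0 <= bspline z.
Proof. by rewrite /bspline; ppart_cases z; nra. Qed.

Lemma bspline_le_sqr z : bspline z <= ppart z ^+ 2.
Proof. by rewrite /bspline; ppart_cases z; nra. Qed.

Lemma bspline_le z : bspline z <= 20.
Proof. by rewrite /bspline; ppart_cases z; nra. Qed.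

Lemma dbspline_le z : dbspline z <= 2 * ppart z.
Proof. by rewrite /dbspline; ppart_cases z; lra. Qed.

Lemma dbspline_bound z : - 20 <= dbspline z <= 8.
Proof. by rewrite /dbspline; ppart_cases z; lra. Qed.

End QuadraticSpline.

(** * Derivatives relative to the unit interval *)

Section PatchedDerivative.
Context {R : realType}.
Implicit Types (F G : R -> R) (x : R).

Local Notation I01 := (@unit_itv R).

(** Properness makes the limit defining [derive01] unique, at the end points
    as well. *)
Lemma within_dnbhs01_proper x : unit_itv x -> ProperFilter (within I01 x^').
Proof.
move=> x01; apply: Build_ProperFilter_ex => P [e /= e0 Pe].
pose d := Num.min (e / 2) (1 / 2).
have [d0 [de d1]] : 0 < d /\ d < e /\ d <= 1 / 2.
  by rewrite /d; case: (leP (e / 2) (1 / 2)) => h; split; lra.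
have yP y : `|x - y| = d -> unit_itv y -> P y.
  move=> xy y01; apply: Pe => //; first by rewrite /ball_/= xy.
  by apply/eqP => yx; move: xy; rewrite yx subrr normr0; lra.
move: x01; rewrite /unit_itv/= => x01; have [x2|x2] := leP x (1 / 2).
  exists (x + d); apply: yP; last by rewrite /unit_itv/=; lra.
  by rewrite opprD addrA subrr sub0r normrN gtr0_norm.
exists (x - d); apply: yP; last by rewrite /unit_itv/=; lra.
by rewrite opprB addrC subrK gtr0_norm.
Qed.

Lemma patch_unit F x : unit_itv x -> patch (fun=> 0) I01 F x = F x.
Proof. by move=> x01; rewrite /patch mem_set. Qed.

(** Dividing the expansion by [y - x] bounds the error of the difference quotient
    by [L * `|y - x|]. *)
Lemma taylor2_diff_quot L F G x : taylor2 L F G -> unit_itv x ->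
  diff_quot (patch (fun=> 0) I01 F) x y @[y --> within I01 x^'] --> G x.
Proof.
move=> T x01; apply/cvgrPdist_lt => e e0.
have [M0 LM] : 0 < `|L| + 1 /\ L <= `|L| + 1.
  by have := normr_ge0 L; have := ler_norm L; lra.
exists (e / (`|L| + 1)) => /=; first by rewrite divr_gt0.
move=> y; rewrite /= ltr_pdivlMr// => xy yx y01.
rewrite /diff_quot !patch_unit//.
have d0 : 0 < `|y - x| by rewrite normr_gt0 subr_eq0.
have dn0 : y - x != 0 by rewrite subr_eq0.
have -> : G x - (F y - F x) / (y - x) = - ((F y - F x - G x * (y - x)) / (y - x)).
  by field.
rewrite normrN normrM normfV ltr_pdivrMr//.
apply: le_lt_trans (T x y) _; rewrite -(real_normK (num_real (y - x))) expr2.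
rewrite mulrA ltr_pM2r//; apply: le_lt_trans xy.
by rewrite -(distrC y x) mulrC ler_pM2l.
Qed.

Lemma taylor2_derivable01 L F G x : taylor2 L F G -> unit_itv x ->
  derivable01 (patch (fun=> 0) I01 F) x.
Proof. by move=> T x01; apply/cvg_ex; exists (G x); exact: taylor2_diff_quot T x01. Qed.

Lemma taylor2_derive01 L F G x : taylor2 L F G -> unit_itv x ->
  derive01 (patch (fun=> 0) I01 F) x = G x.
Proof.
move=> T x01; have PF := within_dnbhs01_proper x01.
by apply: cvg_lim => //; exact: taylor2_diff_quot T x01.
Qed.

Lemma taylor2_C1Lip L F G : taylor2 L F G -> C1Lip (patch (fun=> 0) I01 F).
Proof.
move=> T; apply: (@klipschitzW _ _ _ (2 * L)).
  by apply: (@globally_properfilter _ _ (0, 0)); split => /=; rewrite /unit_itv/=; lra.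
move=> [x y] /= [x01 y01]; rewrite !(taylor2_derive01 T)//.
exact: taylor2_lipschitz T x y.
Qed.

Lemma taylor2_continuous_derive01 L F G : taylor2 L F G ->
  {within I01, continuous (derive01 (patch (fun=> 0) I01 F))}.
Proof.
move=> T; apply: (@subspace_eq_continuous _ _ _ (G : subspace I01 -> R)).
  by move=> x /set_mem x01; apply/esym; exact: taylor2_derive01 T x01.
apply: continuous_subspaceT => x; apply/cvgrPdist_lt => e e0.
have [M0 LM] : 0 < 2 * `|L| + 1 /\ 2 * L <= 2 * `|L| + 1.
  by have := normr_ge0 L; have := ler_norm L; lra.
exists (e / (2 * `|L| + 1)) => /=; first by rewrite divr_gt0.
move=> y; rewrite /= ltr_pdivlMr// => xy; apply: le_lt_trans xy.
apply: le_trans (taylor2_lipschitz T x y) _.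
by rewrite mulrC ler_wpM2l.
Qed.

End PatchedDerivative.

(** * A lower bound for the topological entropy *)

Section EntropyLowerBound.
Context {R : realType} {T : uniformType}.

(** A single entourage bounds the supremum from below, and exponentially many
    separated points for each [n] bound every tail of the upper limit. *)
Lemma topological_entropy_ge (f : T -> T) (A : set T) E (M : nat) :
  entourage E -> (0 < M)%N ->
  (forall n, exists S : {fset T}, [/\ [set` S] `<=` A,
     bowen_separated f n E [set` S] & #|` S| = (M ^ n)%N]) ->
  ((ln M%:R)%:E <= topological_entropy R f A)%E.
Proof.
move=> entE M0 sep.
apply: le_trans (ereal_sup_ubound _); last by exists E.
apply: le_ereal_inf_tmp => _ [V [N _ NV] <-].
apply: le_trans (ereal_sup_ubound _); last first.
  by exists N.+1 => //; apply: NV => /=; exact: leqnSn.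
have M0R : 0 < M%:R :> R by rewrite ltr0n.
have n0 : 0 < N.+1%:R :> R by rewrite ltr0n.
have lnM : (ln M%:R)%:E = ((N.+1%:R^-1)%:E * lne ((M ^ N.+1)%:R%:E) : \bar R)%E.
  rewrite lne_EFin; last by rewrite natrX exprn_gt0.
  by rewrite natrX lnXn// -EFinM -[ln _ *+ _]mulr_natl mulrA mulVf ?mul1r// gt_eqF.
rewrite lnM; apply: lee_wpmul2l; first by rewrite lee_fin invr_ge0 ltW.
have [S [SA Ssep Scard]] := sep N.+1.
have le_sep : (((M ^ N.+1)%:R : R)%:E <= sep_number R f A N.+1 E)%E.
  by apply: ereal_sup_ubound; exists S => //; rewrite Scard.
have pos : (0 < ((M ^ N.+1)%:R : R)%:E)%E by rewrite lte_fin ltr0n expn_gt0 M0.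
rewrite lee_lne// in_itv/= leey andbT; first exact: ltW.
exact: le_trans (ltW pos) le_sep.
Qed.

End EntropyLowerBound.

(** * The uniformity of C^1 convergence *)

Section C1Uniformity.
Context {R : realType}.

Definition C1_near (e : R) (f g : C1space R) : Prop := forall x, unit_itv x ->
  `|f x - g x| < e /\ `|derive01 f x - derive01 g x| < e.

(** [C1space] carries the uniformity induced by the pair (map, derivative); this
    unfolds it to epsilons once and for all. *)
Lemma C1_entourageP (E : set (C1space R * C1space R)) :
  entourage E <-> exists2 e, 0 < e & forall f g, C1_near e f g -> E (f, g).
Proof.
split.
  move=> [D [[D1 D2] /= [entD1 entD2] sD] sE].
  move: entD1 entD2; rewrite !uniform_entourage.
  move=> [P1]; rewrite -entourage_ballE => -[e1 /= e10 sP1] sD1.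
  move=> [P2]; move=> -[e2 /= e20 sP2] sD2.
  exists (Num.min e1 e2); first by rewrite lt_min e10 e20.
  move=> f g fg; apply: sE.
  suff /sD[[[a b] [c d]] /= Dx [ea ec eb ed]] : (D1 `*` D2)
      ((f : {uniform` @unit_itv R -> R}, g : {uniform` @unit_itv R -> R}),
       (derive01 f : {uniform` @unit_itv R -> R}, derive01 g : {uniform` @unit_itv R -> R})).
    by rewrite ea ec eb ed in Dx.
  split; [apply: sD1|apply: sD2] => x x01.
    by apply: sP1 => /=; have [+ _] := fg x x01; rewrite lt_min => /andP[].
  by apply: sP2 => /=; have [_ +] := fg x x01; rewrite lt_min => /andP[].
move=> [e e0 sE].
pose U := [set fg : {uniform` @unit_itv R -> R} * {uniform` @unit_itv R -> R} |
  forall x, unit_itv x -> `|fg.1 x - fg.2 x| < e].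
have entU : entourage U.
  rewrite uniform_entourage; exists [set xy | ball xy.1 e xy.2].
    by rewrite -entourage_ballE; exists e.
  by [].
exists [set xy | U (xy.1.1, xy.2.1) /\ U (xy.1.2, xy.2.2)].
  exact: prod_entP.
by move=> [f g] [/= U1 U2]; apply: sE => x x01; split; [exact: U1|exact: U2].
Qed.

Lemma C1_nbhsP (f : C1space R) (P : set (C1space R)) :
  nbhs f P <-> exists2 e, 0 < e & forall g, C1_near e f g -> P g.
Proof.
rewrite nbhsP; split.
  move=> [E /C1_entourageP[e e0 sE] sP]; exists e => // g fg; apply: sP.
  by apply/xsectionP; exact: sE.
move=> [e e0 sP]; exists [set fg | C1_near e fg.1 fg.2].
  by apply/C1_entourageP; exists e.
by move=> g /xsectionP /= /sP.
Qed.

End C1Uniformity.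

Section QuintuplingFamily.
Context {R : realType}.
Implicit Types (w : nat -> R) (t u v x y : R).

Local Notation I01 := (@unit_itv R).
Local Notation lam := (3 / 25 : R).
Local Notation curv := (225 / 31 : R).
Local Notation crit := (37 / 108 : R).
Local Notation amp := (curv * (293 / 2160) ^+ 2 : R).
Local Notation freq := (2160 / 293 : R).
(* [p0], [q0] and [J_left] are the first three iterates of 0. *)
Local Notation p0 := (928 / 1875 : R).
Local Notation q0 := (947 / 1125 : R).
Local Notation J_left := (178 / 675 : R).
Local Notation J_right := (259 / 675 : R).

(** * The correction at one scale *)

(** The bounds are [lam * rho] and [rho], for [rho = 19/20]: the rescaled annuli
    are then pairwise disjoint.  This [rho] exceeds [1 - c] and [c], so the top
    annulus covers [0, 1] minus a neighbourhood of [c]. *)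
Definition annulus v : Prop := 57 / 500 < `|v| < 19 / 20.

(** The spline of the first line starts at [v = 31/270], where the slope of the
    parabola is [- 5/3], and its first piece, of width [4 / freq], ends exactly
    at [v = 71/108 = 1 - c].  Since [amp * freq ^ 2 = curv], adding
    it to [- curv * v ^ 2] leaves the tangent line.  The second line does the
    same on the left, from [v = - 31/250], where the slope is [9/5].  The last
    term is the bump carrying the parameter; its support
    [- 13/50 <= v <= - 1/5] lies in the gap between [f^2(J)] and [J]. *)
Definition corr t v : R :=
  amp * bspline (freq * v + - (freq * (31 / 270))) +
  amp * bspline (- freq * v + - (freq * (31 / 250))) +
  t / 1000 * bspline (- 100 * v + - 20).

Definition dcorr t v : R :=
  amp * (freq * dbspline (freq * v + - (freq * (31 / 270)))) +
  amp * (- freq * dbspline (- freq * v + - (freq * (31 / 250)))) +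
  t / 1000 * (- 100 * dbspline (- 100 * v + - 20)).

Lemma taylor2_corr t : 0 <= t <= 1 -> taylor2 2000 (corr t) (dcorr t).
Proof.
move=> t01.
have T (a p q : R) := taylor2Z a (taylor2_comp_affine p q (@taylor2_bspline R)).
have := taylor2D (taylor2D (T amp freq (- (freq * (31 / 270))))
  (T amp (- freq) (- (freq * (31 / 250))))) (T (t / 1000) (- 100) (- 20)).
by apply: taylor2W; rewrite !ger0_norm; lra.
Qed.

Lemma corr_out t v : ~ annulus v -> corr t v = 0 /\ dcorr t v = 0.
Proof.
move=> nv; rewrite /corr /dcorr.
have [A [B C]] : (freq * v + - (freq * (31 / 270)) <= 0 \/ 6 <= freq * v + - (freq * (31 / 270))) /\
  (- freq * v + - (freq * (31 / 250)) <= 0 \/ 6 <= - freq * v + - (freq * (31 / 250))) /\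
  (- 100 * v + - 20 <= 0 \/ 6 <= - 100 * v + - 20).
  have [small|big] : `|v| <= 57 / 500 \/ 19 / 20 <= `|v|.
    have [v0|v0] := leP `|v| (57 / 500); first by left.
    have [v1|v1] := leP (19 / 20) `|v|; first by right.
    by exfalso; apply: nv; rewrite /annulus v0 v1.
  - by move: small; rewrite ler_norml => ?; split; [left|split; left]; lra.
  - move: big; rewrite ler_normr => /orP[?|?].
    + by split; [right|split; left]; lra.
    + by split; [left|split; right]; lra.
have Z (z : R) : z <= 0 \/ 6 <= z -> bspline z = 0 /\ dbspline z = 0.
  move=> [z0|z6]; first by rewrite bspline_le0// dbspline_le0.
  by rewrite bspline_ge6// dbspline_ge6.
by have [-> ->] := Z _ A; have [-> ->] := Z _ B; have [-> ->] := Z _ C; rewrite !mulr0 !addr0.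
Qed.

Lemma corr_right t v : 31 / 270 <= v <= 71 / 108 ->
  corr t v = curv * (v - 31 / 270) ^+ 2.
Proof.
move=> hv; rewrite /corr bspline_sqr; last by lra.
rewrite (bspline_le0 (z := - freq * v + _)); last by lra.
rewrite (bspline_le0 (z := - 100 * v + _)); last by lra.
by field.
Qed.

Lemma corr_left t v : - (37 / 108) <= v <= - (31 / 250) ->
  corr t v = curv * (- v - 31 / 250) ^+ 2 + t / 1000 * bspline (- 100 * v + - 20).
Proof.
move=> hv; rewrite /corr (bspline_le0 (z := freq * v + _)); last by lra.
rewrite (bspline_sqr (z := - freq * v + _)); last by lra.
by field.
Qed.

Lemma corr_ge0 t v : 0 <= t -> 0 <= corr t v.
Proof.
move=> t0; rewrite /corr.
have := bspline_ge0 (freq * v + - (freq * (31 / 270))).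
have := bspline_ge0 (- freq * v + - (freq * (31 / 250))).
have := bspline_ge0 (- 100 * v + - 20); nra.
Qed.

Lemma corr_le t v : 0 <= t <= 1 -> corr t v <= curv * v ^+ 2.
Proof.
move=> t01; rewrite /corr.
have [v0|v0] := leP v 0.
  rewrite (bspline_le0 (z := freq * v + _)); last by lra.
  have := bspline_le_sqr (- freq * v + - (freq * (31 / 250))).
  have := bspline_le_sqr (- 100 * v + - 20); have := bspline_le (- 100 * v + - 20).
  have := bspline_ge0 (- 100 * v + - 20).
  case: (ppartP (- 100 * v + _)) => h1; case: (ppartP (- freq * v + _)) => h2; nra.
rewrite (bspline_le0 (z := - freq * v + _)); last by lra.
rewrite (bspline_le0 (z := - 100 * v + _)); last by lra.
have := bspline_le_sqr (freq * v + - (freq * (31 / 270))).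
case: (ppartP (freq * v + _)) => h1; nra.
Qed.

(** The splines remove from the slope of the parabola at most its growth since
    the tangency point, and the bump lowers the slope [9/5] of the line which
    carries it by at most [4/5]. *)
Lemma dcorr_sign t v : 0 <= t <= 1 -> v != 0 ->
  (- (2 * curv) * v + dcorr t v) * v < 0.
Proof.
move=> t01 vn0; have /orP[v0|v0] : (v < 0) || (0 < v) by exact: lt_total vn0.
  rewrite nmulr_llt0// /dcorr.
  rewrite (dbspline_le0 (z := freq * v + _)); last by lra.
  have := dbspline_le (- freq * v + - (freq * (31 / 250))).
  have := dbspline_bound (- 100 * v + - 20).
  have [h|h] := leP (- 100 * v + - 20) 0.
    rewrite (dbspline_le0 h).
    case: (ppartP (- freq * v + _)) => h2 _ ?; lra.
  set X := dbspline (- 100 * v + _) => /andP[_ X8].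
  have X8' : t * X <= 8 by nra.
  case: (ppartP (- freq * v + _)) => h2 ?; lra.
rewrite pmulr_llt0// /dcorr.
rewrite (dbspline_le0 (z := - freq * v + _)); last by lra.
rewrite (dbspline_le0 (z := - 100 * v + _)); last by lra.
have := dbspline_le (freq * v + - (freq * (31 / 270))).
case: (ppartP (freq * v + _)) => h2 ?; lra.
Qed.

Lemma corr_dist t t' v : `|corr t v - corr t' v| <= 2 * `|t - t'|.
Proof.
have -> : corr t v - corr t' v = (t - t') * (bspline (- 100 * v + - 20) / 1000).
  by rewrite /corr; field.
rewrite normrM mulrC ler_wpM2r// ler_norml.
have := bspline_ge0 (- 100 * v + - 20); have := bspline_le (- 100 * v + - 20).
by move=> ? ?; apply/andP; split; lra.
Qed.

Lemma dcorr_dist t t' v : `|dcorr t v - dcorr t' v| <= 2 * `|t - t'|.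
Proof.
have -> : dcorr t v - dcorr t' v = (t - t') * (- dbspline (- 100 * v + - 20) / 10).
  by rewrite /dcorr; field.
rewrite normrM mulrC ler_wpM2r// ler_norml.
have := dbspline_bound (- 100 * v + - 20).
by move=> /andP[? ?]; apply/andP; split; lra.
Qed.

(** * The corrections at all scales *)

Definition level_term (w : nat -> R) k u : R :=
  (- lam) ^+ k * (- lam) ^+ k * corr (w k) (u / (- lam) ^+ k).

Definition dlevel_term (w : nat -> R) k u : R :=
  (- lam) ^+ k * dcorr (w k) (u / (- lam) ^+ k).

(** The scale of [u].  Where no annulus contains [u], all the corrections vanish
    at [u] and the default value is harmless. *)
Definition level (u : R) : nat := xget 0%N [set k | annulus (u / (- lam) ^+ k)].

(** The sum of [level_term w k u] over all [k], of which at most one is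
    nonzero. *)
Definition tower w u := level_term w (level u) u.
Definition dtower w u := dlevel_term w (level u) u.

Lemma lamX_gt0 k : 0 < lam ^+ k.
Proof. by apply: exprn_gt0; lra. Qed.

Lemma lamX_le1 k : lam ^+ k <= 1.
Proof.
have l0 : 0 <= lam by lra.
have l1 : lam <= 1 by lra.
by apply: exprn_ile1.
Qed.

Lemma ratioX_neq0 k : (- lam) ^+ k != 0.
Proof. by rewrite expf_neq0//; lra. Qed.

Lemma norm_ratioX k : `|(- lam) ^+ k| = lam ^+ k.
Proof. by rewrite normrX normrN ger0_norm//; lra. Qed.

Lemma annulus_ratioX u k : annulus (u / (- lam) ^+ k) <->
  57 / 500 * lam ^+ k < `|u| < 19 / 20 * lam ^+ k.
Proof.
by rewrite /annulus normrM normfV norm_ratioX ltr_pdivlMr ?ltr_pdivrMr ?lamX_gt0.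
Qed.

Lemma level_lt_disjoint u i j : (i < j)%N ->
  annulus (u / (- lam) ^+ i) -> ~ annulus (u / (- lam) ^+ j).
Proof.
move=> ij /annulus_ratioX ui /annulus_ratioX uj.
have : lam ^+ j <= lam ^+ i.+1 by apply: ler_wiXn2l => //; lra.
by rewrite exprS; have := lamX_gt0 i; have := lamX_gt0 j; lra.
Qed.

Lemma level_eq u k : annulus (u / (- lam) ^+ k) -> level u = k.
Proof.
move=> uk; rewrite /level; case: xgetP => [i _ /= ui|/(_ k)/(_ uk)//].
have [ik|ki|//] := ltngtP i k; first by case: (level_lt_disjoint ik ui).
by case: (level_lt_disjoint ki uk).
Qed.

Lemma level_term_neq w k u : k != level u ->
  level_term w k u = 0 /\ dlevel_term w k u = 0.
Proof.
move=> ku; rewrite /level_term /dlevel_term.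
have [|-> ->] := @corr_out (w k) (u / (- lam) ^+ k); last by rewrite !mulr0.
by move=> /level_eq uk; rewrite uk eqxx in ku.
Qed.

Definition codes : set (nat -> R) := [set w | forall k, 0 <= w k <= 1].

Lemma taylor2_level_term w k : codes w -> taylor2 2000 (level_term w k) (dlevel_term w k).
Proof.
move=> w01; set r := (- lam) ^+ k.
have rn0 : r != 0 by exact: ratioX_neq0.
have := taylor2Z (r * r) (taylor2_comp_affine r^-1 0 (taylor2_corr (w01 k))).
have -> : `|r * r| * (2000 * r^-1 ^+ 2) = 2000.
  by rewrite ger0_norm -?expr2 ?sqr_ge0//; field.
move=> T x y; have := T x y.
rewrite /level_term /dlevel_term -/r !addr0 ![r^-1 * _]mulrC.
by have -> : r * r * (dcorr (w k) (x / r) / r) = r * dcorr (w k) (x / r) by field.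
Qed.

(** If [x] and [y] have distinct levels, then the term of each of them vanishes
    at the other together with its derivative, so the errors of two terms add
    up. *)
Lemma taylor2_tower w : codes w -> taylor2 4000 (tower w) (dtower w).
Proof.
move=> w01 x y; have T k := taylor2_level_term k w01.
have sq := sqr_ge0 (y - x).
rewrite /tower /dtower; have [e|ne] := eqVneq (level x) (level y).
  by rewrite e; have := T (level y) x y; lra.
have [y0 _] := level_term_neq w ne.
have [x0 dx0] : level_term w (level y) x = 0 /\ dlevel_term w (level y) x = 0.
  by apply: level_term_neq; rewrite eq_sym.
have := T (level x) x y; have := T (level y) x y; rewrite y0 x0 dx0.
rewrite !ler_norml; lra.
Qed.

Definition code_shift (w : nat -> R) k : R := w k.+1.

Lemma codes_code_shift w : codes w -> codes (code_shift w).
Proof. by move=> w01 k; exact: w01. Qed.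

(** Multiplication by [- lam] maps each annulus onto the next one.  For
    [`|u| <= rho], the image is below the top annulus, so the term of level 0
    does not contribute on the left-hand side. *)
Lemma tower_rescale w u : `|u| <= 19 / 20 ->
  tower w (- lam * u) = lam ^+ 2 * tower (code_shift w) u /\
  dtower w (- lam * u) = - lam * dtower (code_shift w) u.
Proof.
move=> hu.
have divS k : - lam * u / (- lam) ^+ k.+1 = u / (- lam) ^+ k.
  by rewrite exprS invfM mulrACA divff ?mul1r//; lra.
have [[k uk]|nu] := pselect (exists k, annulus (u / (- lam) ^+ k)).
  have := uk; rewrite -divS => /level_eq uk'.
  rewrite /tower /dtower (level_eq uk) uk' /level_term /dlevel_term divS exprS.
  by rewrite /code_shift; split; ring.
have zero : level_term (code_shift w) (level u) u = 0 /\ dlevel_term (code_shift w) (level u) u = 0.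
  rewrite /level_term /dlevel_term.
  have [|-> ->] := @corr_out (code_shift w (level u)) (u / (- lam) ^+ level u).
    by move=> ?; apply: nu; exists (level u).
  by rewrite !mulr0.
have zero' : level_term w (level (- lam * u)) (- lam * u) = 0 /\
    dlevel_term w (level (- lam * u)) (- lam * u) = 0.
  rewrite /level_term /dlevel_term; set j := level _.
  have [|-> ->] := @corr_out (w j) (- lam * u / (- lam) ^+ j); last by rewrite !mulr0.
  case: j => [|j]; last by rewrite divS => ?; apply: nu; exists j.
  rewrite /annulus expr0 divr1 normrM normrN (ger0_norm (_ : 0 <= lam)); last by lra.
  by move=> /andP[]; lra.
by rewrite /tower /dtower zero.1 zero.2 zero'.1 zero'.2 !mulr0.
Qed.

Lemma tower_ge0 w u : codes w -> 0 <= tower w u.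
Proof.
move=> w01; rewrite /tower /level_term -expr2 mulr_ge0 ?sqr_ge0//.
by apply: corr_ge0; have /andP[] := w01 (level u).
Qed.

Lemma tower_le w u : codes w -> tower w u <= curv * u ^+ 2.
Proof.
move=> w01; rewrite /tower /level_term -expr2; set r := (- lam) ^+ _.
have rn0 : r != 0 by exact: ratioX_neq0.
have -> : curv * u ^+ 2 = r ^+ 2 * (curv * (u / r) ^+ 2) by field.
by rewrite ler_wpM2l ?sqr_ge0// corr_le.
Qed.

Lemma dtower_sign w u : codes w -> u != 0 ->
  (- (2 * curv) * u + dtower w u) * u < 0.
Proof.
move=> w01 u0; rewrite /dtower /dlevel_term; set r := (- lam) ^+ _.
have rn0 : r != 0 by exact: ratioX_neq0.
have v0 : u / r != 0 by rewrite mulf_neq0 ?invr_neq0.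
have := dcorr_sign (w01 (level u)) v0; set X := dcorr _ _ => neg.
have -> : (- (2 * curv) * u + r * X) * u = r ^+ 2 * ((- (2 * curv) * (u / r) + X) * (u / r)).
  by field.
by rewrite pmulr_rlt0// exprn_even_gt0.
Qed.

Lemma dtower0 w : dtower w 0 = 0.
Proof.
rewrite /dtower /dlevel_term mul0r; have [|_ ->] := @corr_out (w (level 0)) 0.
  by rewrite /annulus normr0; lra.
by rewrite mulr0.
Qed.

Lemma tower0 w : tower w 0 = 0.
Proof.
rewrite /tower /level_term mul0r; have [|-> _] := @corr_out (w (level 0)) 0.
  by rewrite /annulus normr0; lra.
by rewrite mulr0.
Qed.

Lemma tower_top w u : annulus u -> tower w u = corr (w 0%N) u.
Proof.
move=> au; rewrite /tower (@level_eq u 0) ?expr0 ?divr1//.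
by rewrite /level_term expr0 !mul1r divr1.
Qed.

Lemma tower_dist w w' u e :
  (forall k, lam ^+ k * `|w k - w' k| <= e) ->
  `|tower w u - tower w' u| <= 2 * e /\ `|dtower w u - dtower w' u| <= 2 * e.
Proof.
move=> we; have := we (level u).
rewrite /tower /dtower /level_term /dlevel_term; set k := level u.
rewrite -!mulrBr !normrM norm_ratioX.
have := lamX_le1 k; have := lamX_gt0 k; move: (lam ^+ k) => p p0 p1.
have := dcorr_dist (w k) (w' k) (u / (- lam) ^+ k).
have := corr_dist (w k) (w' k) (u / (- lam) ^+ k).
have := normr_ge0 (corr (w k) (u / (- lam) ^+ k) - corr (w' k) (u / (- lam) ^+ k)).
move: `|w k - w' k| `|corr _ _ - _| `|dcorr _ _ - _| => d X Y X0 XD YD pd.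
have pX : p * X <= 2 * e by nra.
by split; [have h : p * (p * X) <= p * X by rewrite ler_piMl ?mulr_ge0 ?(ltW p0)|]; nra.
Qed.

(** * Unimodal maps indexed by sequences *)

(** The shape of these formulas makes [taylor2_profile] a composition of the
    rules for [taylor2]; [profileE] and [dprofileE] are the readable forms. *)
Definition profile w x : R :=
  1 + - curv * (1 * x + - crit) ^+ 2 + tower w (1 * x + - crit).

Definition dprofile w x : R :=
  0 + 1 * (- curv * (2 * (1 * x + - crit))) + 1 * dtower w (1 * x + - crit).

Definition qmap w : R -> R := patch (fun=> 0) I01 (profile w).

Lemma taylor2_profile w : codes w -> exists L, taylor2 L (profile w) (dprofile w).
Proof.
move=> w01; eexists; apply: taylor2D.
  apply: taylor2D; first exact: taylor2_cst.
  exact: (taylor2_comp_affine 1 (- crit) (taylor2_sqr (- curv))).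
exact: (taylor2_comp_affine 1 (- crit) (taylor2_tower w01)).
Qed.

Lemma profileE w x : profile w x = 1 - curv * (x - crit) ^+ 2 + tower w (x - crit).
Proof. by rewrite /profile !mul1r mulNr. Qed.

Lemma dprofileE w x :
  dprofile w x = - (2 * curv) * (x - crit) + dtower w (x - crit).
Proof. by rewrite /dprofile !mul1r add0r !mulNr mulrA [curv * 2]mulrC. Qed.

Lemma profile_right w x : crit + 31 / 270 <= x <= 1 ->
  profile w x = 5 / 3 * (1 - x).
Proof.
move=> hx; rewrite profileE tower_top; last first.
  by rewrite /annulus ger0_norm; lra.
by rewrite corr_right; [field|lra].
Qed.

Lemma profile_left w x : 0 <= x <= crit - 31 / 250 ->
  profile w x = p0 + 9 / 5 * x + w 0%N / 1000 * bspline (- 100 * (x - crit) + - 20).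
Proof.
move=> hx; rewrite profileE tower_top; last first.
  by rewrite /annulus ler0_norm; lra.
rewrite corr_left; last by lra.
by set B := bspline _; field.
Qed.

(** On the two sides [profile] is a line plus a nonnegative bump; in the middle
    it lies between the parabola and 1. *)
Lemma profile_bounds w x : codes w -> unit_itv x -> 0 <= profile w x <= 1.
Proof.
move=> w01; rewrite /unit_itv/= => x01; apply/andP; split; last first.
  by rewrite profileE; have := tower_le (x - crit) w01; lra.
have [x1|x1] := leP (crit + 31 / 270) x; first by rewrite profile_right; lra.
have [x2|x2] := leP x (crit - 31 / 250).
  rewrite profile_left; last by lra.
  have /andP[w0 _] := w01 0%N.
  have := bspline_ge0 (- 100 * (x - crit) + - 20); set B := bspline _ => B0.
  have := mulr_ge0 w0 B0; lra.
rewrite profileE; have := tower_ge0 (x - crit) w01.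
have : (x - crit) ^+ 2 <= (31 / 250) ^+ 2 by nra.
lra.
Qed.

Lemma qmap_selfmap w : codes w -> selfmap01 (qmap w).
Proof.
move=> w01; split => [x x01|x nx]; first by rewrite /qmap patch_unit//; exact: profile_bounds.
by rewrite /qmap /patch memNset.
Qed.

Lemma qmap_unimodal w : codes w -> unimodal (qmap w) crit.
Proof.
move=> w01; have [L T] := taylor2_profile w01.
have c01 : unit_itv crit by rewrite /unit_itv/=; lra.
split => //.
- split; first exact: qmap_selfmap.
  + by move=> x x01; exact: taylor2_derivable01 T x01.
  + exact: taylor2_continuous_derive01 T.
- move=> x x01; rewrite (taylor2_derive01 T)// dprofileE; split; last first.
    by move=> ->; rewrite subrr mulr0 dtower0 addr0.
  move=> d0; apply/eqP; rewrite -subr_eq0; apply/negPn/negP => u0.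
  by have := dtower_sign w01 u0; rewrite d0 mul0r ltxx.
- by rewrite /qmap patch_unit// profileE subrr tower0 expr0n/= mulr0 subr0 addr0.
- rewrite /qmap patch_unit; last by rewrite /unit_itv/=; lra.
  by rewrite profile_right; lra.
Qed.

Lemma qmap_C1Lip w : codes w -> C1Lip (qmap w).
Proof. by move=> /taylor2_profile[L T]; exact: taylor2_C1Lip T. Qed.

(** * Renormalization acts as the shift *)

Lemma qmap_right w x : crit + 31 / 270 <= x <= 1 -> qmap w x = 5 / 3 * (1 - x).
Proof.
by move=> hx; rewrite /qmap patch_unit ?profile_right//; rewrite /unit_itv/=; lra.
Qed.

Lemma qmap_left w x : 0 <= x <= 3 / 125 -> qmap w x = p0 + 9 / 5 * x.
Proof.
move=> hx; rewrite /qmap patch_unit; last by rewrite /unit_itv/=; lra.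
rewrite profile_left ?bspline_ge6 ?mulr0 ?addr0//; lra.
Qed.

(** The graph over [J] is an affine copy of the graph of the shifted map: both
    the parabola and the tower are homogeneous under [u |-> - lam * u]. *)
Lemma qmap_renorm_itv w x : unit_itv x ->
  qmap w (J_right - lam * x) = 1 - lam ^+ 2 * (1 - qmap (code_shift w) x).
Proof.
rewrite /unit_itv/= => x01.
rewrite /qmap !patch_unit; [|by rewrite /unit_itv/=; lra..].
rewrite !profileE.
have -> : J_right - lam * x - crit = - lam * (x - crit) by field.
rewrite (tower_rescale _ _).1; last by rewrite ler_norml; lra.
by set t := tower _ _; field.
Qed.

(** The four steps from [f(J) = [1 - lam ^ 2, 1]] back to [J] stay on the lines
    of slopes [- 5/3], [9/5], [- 5/3], [- 5/3]; the bounds locate the intervals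
    [f^2(J)], [f^3(J)] and [f^4(J)]. *)
Lemma qmap_return w y : 616 / 625 <= y <= 1 ->
  [/\ 0 <= qmap w y <= 3 / 125,
      p0 <= iter 2 (qmap w) y <= p0 + 27 / 625,
      q0 - 9 / 125 <= iter 3 (qmap w) y <= q0 &
      iter 4 (qmap w) y = J_left + 25 / 3 * (1 - y)].
Proof.
move=> hy.
have e1 : qmap w y = 5 / 3 * (1 - y) by rewrite qmap_right; lra.
have e2 : iter 2 (qmap w) y = p0 + 3 * (1 - y).
  by rewrite iterS /= e1 qmap_left; clear e1; lra.
have e3 : iter 3 (qmap w) y = q0 - 5 * (1 - y).
  by rewrite iterS e2 qmap_right; clear e1 e2; lra.
have e4 : iter 4 (qmap w) y = J_left + 25 / 3 * (1 - y).
  by rewrite iterS e3 qmap_right; clear e1 e2 e3; lra.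
by split; [rewrite e1|rewrite e2|rewrite e3|exact: e4]; clear e1 e2 e3 e4; lra.
Qed.

Lemma qmap_orbit3 w : iter 3 (qmap w) 0 = J_left.
Proof.
have e1 : qmap w 0 = p0 by rewrite qmap_left; lra.
have e2 : qmap w p0 = q0 by rewrite qmap_right; lra.
by rewrite /= e1 e2 qmap_right; lra.
Qed.

Lemma qmap_J w x : codes w -> J_left <= x <= J_right ->
  616 / 625 <= qmap w x <= 1.
Proof.
move=> w01 hx; have -> : x = J_right - lam * ((J_right - x) / lam) by field.
have y01 : unit_itv ((J_right - x) / lam) by rewrite /unit_itv/=; lra.
rewrite qmap_renorm_itv//.
have /andP[] := (qmap_selfmap (codes_code_shift w01)).1 _ y01; lra.
Qed.

Lemma qmap_iter5 w x : codes w -> unit_itv x ->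
  iter 5 (qmap w) (J_right - lam * x) = J_right - lam * qmap (code_shift w) x.
Proof.
move=> w01 x01; rewrite iterSr.
have hJ : J_left <= J_right - lam * x <= J_right.
  by move: x01; rewrite /unit_itv/=; lra.
have [_ _ _ ->] := qmap_return w (qmap_J w01 hJ).
by rewrite qmap_renorm_itv//; field.
Qed.

Lemma qmap_orbit8 w : codes w -> iter 8 (qmap w) 0 = J_right.
Proof.
move=> w01; rewrite (iterD 5 3) qmap_orbit3.
have -> : J_left = J_right - lam * 1 by field.
rewrite qmap_iter5//; last by rewrite /unit_itv/=; lra.
by have [_ _ _ _ ->] := qmap_unimodal (codes_code_shift w01); rewrite mulr0 subr0.
Qed.

Lemma renorm_itv_qmap w : codes w ->
  renorm_itv (qmap w) = [set x | J_left <= x <= J_right].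
Proof. by move=> w01; rewrite /renorm_itv qmap_orbit3 qmap_orbit8. Qed.

Lemma renorm_qmap w : codes w ->
  renorm (qmap w : C1space R) = (qmap (code_shift w) : C1space R).
Proof.
move=> w01; rewrite /renorm qmap_orbit3 qmap_orbit8//; apply/funext => x.
have [x01|nx] := pselect (unit_itv x); last by rewrite /qmap /patch memNset.
rewrite patch_unit//.
have -> : line_path J_right J_left x = J_right - lam * x.
  by rewrite /line_path; field.
by rewrite qmap_iter5// /factor; field.
Qed.

Lemma disjoint_itv_images (A B : set R) (l1 r1 l2 r2 : R) :
  r1 < l2 -> A `<=` [set x | l1 <= x <= r1] -> B `<=` [set x | l2 <= x <= r2] ->
  A° `&` B° = set0 /\ (forall x y, A x -> B y -> x <= y).
Proof.
move=> lr hA hB; have le12 x y : A x -> B y -> x < y.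
  by move=> /hA/= /andP[_ xr] /hB/= /andP[ly _]; lra.
split; last by move=> x y Ax By; exact/ltW/le12.
apply/seteqP; split => // x [/interior_subset Ax /interior_subset Bx].
by have := le12 x x Ax Bx; rewrite ltxx.
Qed.

Lemma qmap_renormalizable w : codes w -> quintupling_renormalizable (qmap w).
Proof.
move=> w01; exists crit; split; first exact: qmap_unimodal.
have crit_J : iter 3 (qmap w) 0 < crit < iter 8 (qmap w) 0.
  by rewrite qmap_orbit3 qmap_orbit8//; lra.
rewrite /= renorm_itv_qmap//; set J := [set x | _].
(* Enclosing intervals for the images of [J], from left to right. *)
pose lo := nth 0 [:: 0; J_left; p0; q0 - 9 / 125; 616 / 625].
pose hi := nth 0 [:: 3 / 125; J_right; p0 + 27 / 625; q0; 1].
have img i : (i < 5)%N -> iter (nth 0%N quintupling_order i) (qmap w) @` J `<=`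
    [set x | lo i <= x <= hi i].
  move=> i5 _ [x Jx <-]; have Jf := qmap_J w01 Jx.
  have [i1 i2 i3 i4] := qmap_return w Jf.
  by case: i i5 => [|[|[|[|[|]]]]] // _; rewrite /lo /hi /=.
split.
- exact: crit_J.
- clear crit_J img; split; last by move=> /(_ 0); rewrite /unit_itv /J/=; lra.
  by move=> x; rewrite /J /unit_itv/=; lra.
- move=> i j /andP[ij j5].
  clear crit_J; apply: (disjoint_itv_images _ (img i (ltn_trans ij j5)) (img j j5)).
  case: i ij => [|[|[|[|i]]]]; case: j j5 => [|[|[|[|[|j]]]]] //= _ _; clear img;
    rewrite /lo /hi /=; lra.
- move=> _ [x Jx <-]; have Jf := qmap_J w01 Jx.
  have [_ _ _] := qmap_return w Jf; rewrite -iterSr => ->.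
  by clear img crit_J; rewrite /J/=; lra.
Qed.

Lemma qmap_renorm_domain w : codes w -> renorm_domain (qmap w : C1space R).
Proof. by move=> w01; split; [exact: qmap_renormalizable|exact: qmap_C1Lip]. Qed.

(** * Compactness and continuity *)

(** Sequences with the product topology, for which Tychonoff's theorem applies. *)
Definition code_space := prod_topology (fun _ : nat => R).

Definition code_set : set code_space := codes.

Definition qspace (w : code_space) : C1space R := qmap w.

Definition code_family : set (C1space R) := qspace @` code_set.

Lemma derive01_qmap w x : codes w -> unit_itv x -> derive01 (qmap w) x = dprofile w x.
Proof. by move=> /taylor2_profile[L T]; exact: taylor2_derive01 T. Qed.

(** The coordinate of index [k] acts on the derivative with a weight at most of
    order [lam ^ k], and even less on the map. *)
Lemma qmap_near w w' e : codes w -> codes w' -> 0 < e ->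
  (forall k, lam ^+ k * `|w k - w' k| <= e / 4) -> C1_near e (qmap w) (qmap w').
Proof.
move=> w01 w'01 e0 we x x01; rewrite !derive01_qmap// /qmap !patch_unit//.
have [d1 d2] := tower_dist (x - crit) we.
have -> : profile w x - profile w' x = tower w (x - crit) - tower w' (x - crit).
  by rewrite !profileE; ring.
have -> : dprofile w x - dprofile w' x = dtower w (x - crit) - dtower w' (x - crit).
  by rewrite !dprofileE; ring.
by split; apply: le_lt_trans; [exact: d1| |exact: d2|]; lra.
Qed.

Lemma small_lamX (e : R) : 0 < e -> exists n, forall k, (n <= k)%N -> lam ^+ k <= e.
Proof.
move=> e0; have l1 : `|lam| < 1 by rewrite ger0_norm; lra.
have /cvgrPdist_lt/(_ e e0)[n _ nP] := cvg_expr l1.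
exists n => k nk; have := nP k nk; rewrite /= sub0r normrN.
by rewrite ger0_norm ?(ltW (lamX_gt0 k)) => // /ltW.
Qed.

Lemma code_near_prefix (w : code_space) m (d : R) : 0 < d ->
  \forall w' \near w, forall k, (k < m)%N -> `|w k - w' k| < d.
Proof.
move=> d0; elim: m => [|m IHm].
  by apply: (@nearW _ (nbhs w)) => w' k; rewrite ltn0.
have near_m : \forall w' \near w, `|w m - w' m| < d.
  apply: (@proj_continuous nat (fun=> R) m w [set y | `|w m - y| < d]).
  exact: (@nbhsx_ballx R R (w m) d d0).
move: IHm near_m; apply: (@filterS2 _ (nbhs w)) => w' IHm near_m k.
by rewrite ltnS leq_eqVlt => /predU1P[->|/IHm].
Qed.

(** Beyond a finite prefix the weights [lam ^ k] are small, and the coordinates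
    are bounded: closeness on the prefix suffices. *)
Lemma qspace_continuous : {within code_set, continuous qspace}.
Proof.
apply/subspace_continuousP => w w01 P /C1_nbhsP[e e0 sP].
have e4 : 0 < e / 4 by lra.
have [n nP] := small_lamX e4.
move: (code_near_prefix w n e4); apply: (@filterS _ (nbhs w)) => w' ww' w'01; apply: sP.
apply: qmap_near => // k; have := lamX_le1 k; have := lamX_gt0 k.
have [kn|nk] := ltnP k n.
  have := ww' k kn; have := normr_ge0 (w k - w' k).
  by move: (lam ^+ k) `|w k - w' k| => p d; nra.
have := nP k nk; have : `|w k - w' k| <= 1.
  by rewrite ler_norml; have := w01 k; have := w'01 k; lra.
have := normr_ge0 (w k - w' k).
by move: (lam ^+ k) `|w k - w' k| => p d; nra.
Qed.

Lemma compact_code_set : compact code_set.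
Proof.
have -> : code_set = [set w | forall k, `[0, 1]%classic (w k)].
  by apply/seteqP; split => w w01 k; have := w01 k; rewrite /= in_itv.
by apply: (@tychonoff nat (fun=> R) (fun=> `[0, 1]%classic)) => _; exact: segment_compact.
Qed.

Lemma compact_code_family : compact code_family.
Proof. exact: continuous_compact qspace_continuous compact_code_set. Qed.

Lemma code_family_domain : code_family `<=` renorm_domain (R := R).
Proof. by move=> _ [w w01 <-]; exact: qmap_renorm_domain. Qed.

Lemma renorm_code_family : @renorm R @` code_family `<=` code_family.
Proof.
move=> _ [_ [w w01 <-] <-]; exists (code_shift w); first exact: codes_code_shift.
by rewrite /qspace renorm_qmap.
Qed.

(** On [J] the maps are copies of their renormalizations, reduced by [lam ^ 2] in
    value and by [lam] in slope. *)
Lemma renorm_near e w w' : codes w -> codes w' -> 0 < e ->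
  C1_near (lam ^+ 2 * e) (qmap w) (qmap w') ->
  C1_near e (qmap (code_shift w)) (qmap (code_shift w')).
Proof.
move=> w01 w'01 e0 ww' x x01.
have s01 := codes_code_shift w01; have s'01 := codes_code_shift w'01.
have y01 : unit_itv (J_right - lam * x) by move: x01; rewrite /unit_itv/=; lra.
have [] := ww' _ y01.
rewrite !derive01_qmap// !qmap_renorm_itv// !dprofileE.
have -> : J_right - lam * x - crit = - lam * (x - crit) by field.
have x19 : `|x - crit| <= 19 / 20.
  by move: x01; rewrite /unit_itv/= ler_norml; lra.
rewrite !(tower_rescale _ x19).2.
move: (qmap _ x) (qmap _ x) (dtower _ _) (dtower _ _) => a b c d.
rewrite !ltr_norml => h1 h2; split; lra.
Qed.

Lemma renorm_continuous : {within code_family, continuous (@renorm R)}.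
Proof.
apply/subspace_continuousP => _ [w w01 <-] P /C1_nbhsP[e e0 sP].
have le0 : 0 < lam ^+ 2 * e by apply: mulr_gt0 => //; lra.
apply/C1_nbhsP; exists (lam ^+ 2 * e) => // g ww' [w' w'01 ew'].
rewrite -{}ew' in ww' *; apply: sP.
by have := renorm_near w01 w'01 e0 ww'; rewrite -!renorm_qmap.
Qed.

(** * Infinite entropy *)

(** The probe point is the one where the bump has [z = - 100 * v - 20 = 4], at the
    end of the first piece of the spline; there the map reads off the first
    letter of its sequence. *)
Lemma qmap_probe w : qmap w (crit - 6 / 25) =
  928 / 1875 + 9 / 5 * (crit - 6 / 25) + 2 / 125 * w 0%N.
Proof.
rewrite /qmap patch_unit; last by rewrite /unit_itv/=; lra.
rewrite profile_left; last by lra.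
by rewrite bspline_sqr; [field|lra].
Qed.

Definition word (n M : nat) (s : {ffun 'I_n -> 'I_M}) (k : nat) : R :=
  if insub k is Some i then (s i)%:R / M%:R else 0.

Lemma word_codes n M (s : {ffun 'I_n -> 'I_M}) : codes (word s).
Proof.
move=> k; rewrite /word; case: insubP => [i _ _|_]; last by lra.
have M0 : 0 < M%:R :> R by rewrite ltr0n (leq_ltn_trans _ (ltn_ord (s i))).
by rewrite divr_ge0 ?ler0n//= ler_pdivrMr// mul1r ler_nat ltnW.
Qed.

Lemma iter_renorm_qmap i w : codes w ->
  codes (fun k => w (i + k)%N) /\
  iter i (@renorm R) (qmap w) = qmap (fun k => w (i + k)%N).
Proof.
move=> w01; elim: i => [|i [IHc IHi]]; first by [].
split=> [k|]; first exact: w01.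
rewrite iterS IHi renorm_qmap//; congr qmap; apply/funext => k.
by rewrite /code_shift addnS addSn.
Qed.

Lemma word_dist n M (s t : {ffun 'I_n -> 'I_M}) i : s i != t i ->
  1 <= M%:R * `|word s i - word t i|.
Proof.
move=> st; rewrite /word !valK -mulrBl normrM.
have M0 : 0 < M%:R :> R by rewrite ltr0n (leq_ltn_trans _ (ltn_ord (s i))).
rewrite normfV [X in _ / X]ger0_norm ?ler0n// mulrC divfK ?gt_eqF//.
have [lt|lt|eq] := ltngtP (s i : nat) (t i); last by rewrite (val_inj eq) eqxx in st.
  by rewrite distrC -natrB ?(ltnW lt)// normr_nat ler1n subn_gt0.
by rewrite -natrB ?(ltnW lt)// normr_nat ler1n subn_gt0.
Qed.

Lemma word_separated n M (s t : {ffun 'I_n -> 'I_M}) : s != t ->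
  exists2 i, (i < n)%N & ~ C1_near (2 / 125 / M%:R)
    (iter i (@renorm R) (qmap (word s))) (iter i (@renorm R) (qmap (word t))).
Proof.
move=> st; have [i sti] : exists i, s i != t i.
  apply/existsP; apply: contraNT st; rewrite negb_exists => /forallP eqst.
  by apply/eqP/ffunP => i; apply/eqP; have := eqst i; rewrite negbK.
exists i => //; rewrite !(iter_renorm_qmap _ (word_codes _)).2.
have p01 : unit_itv (crit - 6 / 25) by rewrite /unit_itv/=; lra.
move=> /(_ _ p01)[+ _]; rewrite !qmap_probe addn0.
have M0 : 0 < M%:R :> R by rewrite ltr0n (leq_ltn_trans _ (ltn_ord (s i))).
have := word_dist sti; move: (word s i) (word t i) => a b ab.
rewrite ltr_pdivlMr//.
have -> : 928 / 1875 + 9 / 5 * (crit - 6 / 25) + 2 / 125 * a -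
  (928 / 1875 + 9 / 5 * (crit - 6 / 25) + 2 / 125 * b) = 2 / 125 * (a - b) by ring.
rewrite normrM ger0_norm; last by lra.
by move: ab; move: M%:R `|a - b| => m d; nra.
Qed.

Lemma code_family_entropy_ge M : (0 < M)%N ->
  ((ln M%:R)%:E <= topological_entropy R (@renorm R) code_family)%E.
Proof.
move=> M0; have e0 : 0 < 2 / 125 / M%:R :> R by rewrite divr_gt0 ?ltr0n//; lra.
apply: (@topological_entropy_ge _ _ _ _
  [set fg | C1_near (2 / 125 / M%:R) fg.1 fg.2]) => //.
  by apply/C1_entourageP; exists (2 / 125 / M%:R).
move=> n; pose F (s : {ffun 'I_n -> 'I_M}) : C1space R := qmap (word s).
have F_inj : injective F.
  move=> s t Fst; apply/eqP/negPn/negP => /word_separated[i _]; apply.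
  rewrite -/(F s) -/(F t) Fst => x x01; rewrite !subrr normr0; split; exact: e0.
exists [fset F s | s in {ffun 'I_n -> 'I_M}]%fset; split.
- by move=> _ /imfsetP[s _ ->]; exists (word s) => //; exact: word_codes.
- move=> _ _ /imfsetP[s _ ->] /imfsetP[t _ ->] Fst.
  by apply: word_separated; apply: contra_notN Fst => /eqP ->.
- by rewrite card_imfset//= -cardE card_ffun !card_ord.
Qed.

Lemma code_family_entropy : topological_entropy R (@renorm R) code_family = +oo%E.
Proof.
apply/eqyP => r r0; pose M := Num.truncn (expR r).
apply: le_trans (code_family_entropy_ge (ltn0Sn M)).
rewrite lee_fin -[leLHS]expRK ler_ln ?posrE ?expR_gt0 ?ltr0n//.
by apply/ltW; exact: truncnS_gt.
Qed.

Lemma renorm_entropy_infty : renorm_entropy R = +oo%E.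
Proof.
apply/eqP; rewrite -leye_eq -code_family_entropy; apply: ereal_sup_ubound.
exists code_family => //; split; [exact: code_family_domain|exact: compact_code_family|
  exact: renorm_code_family|exact: renorm_continuous].
Qed.

(** * Fixed points *)

(** Any injection of the reals into [0, 1] would do. *)
Definition constant_code (t : R) : nat -> R := fun=> (1 + expR t)^-1.

Lemma constant_code_codes t : codes (constant_code t).
Proof.
move=> k; rewrite /constant_code; have := expR_gt0 t => t0.
by rewrite invr_ge0 invf_le1; lra.
Qed.

Lemma qmap_constant_fixed t : renorm_fixed R (qmap (constant_code t) : C1space R).
Proof.
have c01 := constant_code_codes t.
by split; [exact: qmap_renorm_domain|rewrite renorm_qmap].
Qed.

Lemma qmap_constant_inj : injective (fun t => qmap (constant_code t) : C1space R).
Proof.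
move=> s t /(congr1 (fun f : R -> R => f (crit - 6 / 25))).
have n0 : 2 / 125 != 0 :> R by rewrite mulf_neq0 ?invr_neq0 ?pnatr_eq0.
by rewrite !qmap_probe => /addrI /(mulfI n0) /invr_inj /addrI /expR_inj.
Qed.

End QuintuplingFamily.

Local Open Scope card_scope.

Theorem theorem3p6 (R : realType) :
  renorm_entropy R = +oo%E /\
  exists F : set (C1space R), F `<=` renorm_fixed R /\ F #= [set: R].
Proof.
split; first exact: renorm_entropy_infty.
exists (range (fun t => qmap (constant_code t) : C1space R)); split.
  by move=> _ [t _ <-]; exact: qmap_constant_fixed.
by apply: inj_card_eq => s t _ _; exact: qmap_constant_inj.
Qed.
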